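(* Let $(X,d)$ be a complete metric space with $|X|\ge 3$ and let $T:X\to X$ be a mapping contracting hypotenuse of a right-angled triangle. If $T$ does not possess any periodic point of prime period $2$, then the fixed point set $\mathrm{Fix}(T)=\{x\in X: Tx=x\}$ is non-empty.
   Context: Let $(X,d)$ be a metric space with $|X|\ge 3$. A mapping $T:X\to X$ is called a mapping contracting hypotenuse of a right-angled triangle if there exists $\beta$ with $0\le\beta<1$ such that $$[d(Tx,Ty)]^2+[d(Ty,Tz)]^2\le \beta\left([d(x,y)]^2+[d(y,z)]^2\right)$$ for any three pairwise distinct points $x,y,z\in X$. A periodic point of $T$ of prime period $2$ is a point $x\in X$ with $T(Tx)=x$ and $Tx\ne x$. *)

(* Defs.v *)
From HB Require Import structures.
From mathcomp Require Import all_boot all_order all_algebra.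
From mathcomp Require Import all_classical all_reals all_analysis.

Set Implicit Arguments.
Unset Strict Implicit.
Unset Printing Implicit Defensive.

Import Order.TTheory GRing.Theory Num.Theory.

Local Open Scope classical_set_scope.
Local Open Scope ring_scope.

#[short(type="completeMetricType")]
HB.structure Definition CompleteMetric (R : numDomainType) :=
  { X of Metric R X & Complete X }.

Section mappings.
Context {R : realType} {X : metricType R}.
Implicit Type T : X -> X.

Definition contracting_hypotenuse T : Prop :=
  exists beta : R, 0 <= beta < 1 /\
    forall x y z : X, x != y -> y != z -> x != z ->
      mdist (T x) (T y) ^+ 2 + mdist (T y) (T z) ^+ 2
        <= beta * (mdist x y ^+ 2 + mdist y z ^+ 2).

Definition periodic_point2 T (x : X) : Prop := T (T x) = x /\ T x <> x.

Definition fixed_points T : set X := [set x | T x = x].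

End mappings.

(* Main.v *)
Require Import Defs.
From HB Require Import structures.
From mathcomp Require Import all_boot all_order all_algebra.
From mathcomp Require Import all_classical all_reals all_analysis.
From mathcomp Require Import ring lra.

(** Suppose that [T] has no fixed point.  Without periodic points of prime
    period 2, any three consecutive points of an orbit [u n := iter n T x] are
    then pairwise distinct, so the contraction hypothesis applies to all of
    them: the squared legs [d(u n, u n.+1)^2 + d(u n.+1, u n.+2)^2] decrease
    geometrically with ratio [beta].  Hence the steps of the orbit are bounded
    by a geometric sequence of ratio [sqrt beta < 1], and the orbit converges
    to some [l] by completeness ([cvgn_geometric_steps]).

    [T] is a priori not continuous, but the hypothesis applied to the triple
    [l, u n, u n.+1] bounds [d(T l, u n.+1)] by the two small distances
    [d(l, u n)] and [d(u n, u n.+1)].  This needs [u n] and [u n.+1] to differ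
    from [l].  The orbit may pass through [l], but since three consecutive
    points are distinct it avoids [l] at two consecutive times after any given
    time ([avoid_twice]).  So [d(T l, l)] is arbitrarily small, that is,
    [T l = l], a contradiction. *)

Set Implicit Arguments.
Unset Strict Implicit.
Unset Printing Implicit Defensive.

Import Order.TTheory GRing.Theory Num.Theory.

Local Open Scope classical_set_scope.
Local Open Scope ring_scope.

(** The form [C * q ^+ n * (1 - q ^+ m)] of the bound is the partial sum of a
    geometric series, cleared of the denominator [1 - q]; it makes the
    induction on [m] an algebraic identity. *)
Lemma mdist_geometric_steps (R : realFieldType) (X : metricType R) (u : X^nat)
    (C q : R) : q < 1 ->
    (forall n, mdist (u n) (u n.+1) <= C * q ^+ n) ->
  forall n m, (1 - q) * mdist (u n) (u (n + m)%N)
                <= C * q ^+ n * (1 - q ^+ m).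
Proof.
move=> q1 step n; elim=> [|m IHm].
  by rewrite addn0 mdistxx expr0 subrr !mulr0.
apply: (@le_trans _ _ ((1 - q) * (mdist (u n) (u (n + m)%N) +
                                  C * q ^+ (n + m)))).
  rewrite ler_pM2l ?subr_gt0// (le_trans (metric_triangle _ (u (n + m)%N) _))//.
  by rewrite lerD2l addnS step.
rewrite mulrDr (le_trans (lerD IHm (lexx _)))// exprD exprS.
by rewrite le_eqVlt; apply/orP; left; apply/eqP; ring.
Qed.

Lemma cvgn_geometric_steps (R : realType) (X : completeMetricType R)
    (u : X^nat) (C q : R) : 0 <= q < 1 ->
    (forall n, mdist (u n) (u n.+1) <= C * q ^+ n) ->
  cvgn u.
Proof.
move=> /andP[q0 q1] step; apply/cauchy_cvgP/cauchy_exP => e e0.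
have C0 : 0 <= C by rewrite -[C]mulr1 -(expr0 q) (le_trans (mdist_ge0 _ _) (step 0)).
have d0 : 0 < 1 - q by rewrite subr_gt0.
have : \forall n \near \oo, `|geometric C q n| < (1 - q) * e.
  apply: (cvgr0_norm_lt (fun n => geometric C q n : R^o)); last exact: mulr_gt0.
  by apply: cvg_geometric; rewrite ger0_norm.
case=> N _ /(_ N (leqnn N)) /=; rewrite ger0_norm; last first.
  by rewrite mulr_ge0// exprn_ge0.
move=> smallN; exists (u N); exists N => // k /= Nk.
rewrite -metricType_numDomainType.ball_mdistE /= -(ltr_pM2l d0).
apply: le_lt_trans smallN.
rewrite -(subnKC Nk) (le_trans (mdist_geometric_steps q1 step _ _))//.
by rewrite ler_piMr ?mulr_ge0 ?exprn_ge0// gerBl exprn_ge0.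
Qed.

(** After a visit to [l] the next two times are away from [l]; so one of the
    pairs of times [(N, N+1)], [(N+1, N+2)], [(N+2, N+3)] qualifies. *)
Lemma avoid_twice (A : eqType) (u : nat -> A) (l : A) :
    (forall n, u n != u n.+1) -> (forall n, u n != u n.+2) ->
  forall N, exists n, [/\ (N <= n)%N, l != u n & l != u n.+1].
Proof.
move=> u1 u2 N; have [lN|lN] := eqVneq l (u N).
  by exists N.+1; rewrite lN leqnSn u1 u2.
have [lN1|lN1] := eqVneq l (u N.+1); last by exists N; rewrite leqnn.
by exists N.+2; rewrite lN1 u1 u2 -addn2 leq_addr.
Qed.

Section orbit.
Context {R : realType} {X : metricType R}.
Variables (T : X -> X) (beta : R) (u : X^nat).
Hypothesis beta01 : 0 <= beta < 1.
Hypothesis contr : forall x y z : X, x != y -> y != z -> x != z ->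
  mdist (T x) (T y) ^+ 2 + mdist (T y) (T z) ^+ 2
    <= beta * (mdist x y ^+ 2 + mdist y z ^+ 2).
Hypothesis uS : forall n, u n.+1 = T (u n).
Hypotheses (u1 : forall n, u n != u n.+1) (u2 : forall n, u n != u n.+2).

Let legs n := mdist (u n) (u n.+1) ^+ 2 + mdist (u n.+1) (u n.+2) ^+ 2.

Lemma legs_geometric n : legs n <= beta ^+ n * legs 0%N.
Proof.
have /andP[b0 _] := beta01.
elim: n => [|n IHn]; first by rewrite expr0 mul1r.
apply: (@le_trans _ _ (beta * legs n)); last by rewrite exprS -mulrA ler_wpM2l.
by have := contr (u1 n) (u1 n.+1) (u2 n); rewrite -!uS.
Qed.

Lemma orbit_step n :
  mdist (u n) (u n.+1) <= Num.sqrt (legs 0%N) * Num.sqrt beta ^+ n.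
Proof.
have /andP[b0 _] := beta01.
have legs0 : 0 <= legs 0%N by rewrite addr_ge0// sqr_ge0.
have bound0 : 0 <= Num.sqrt (legs 0%N) * Num.sqrt beta ^+ n.
  by rewrite mulr_ge0 ?exprn_ge0 ?sqrtr_ge0.
rewrite -(ler_pXn2r (ltn0Sn 1)) ?nnegrE ?mdist_ge0//.
rewrite exprMn exprAC !sqr_sqrtr// mulrC (le_trans _ (legs_geometric n))//.
by rewrite lerDl sqr_ge0.
Qed.

(** The estimate replacing the continuity of [T] at [l]. *)
Lemma mdist_image_le l n e : l != u n -> l != u n.+1 ->
    mdist l (u n) <= e -> mdist l (u n.+1) <= e ->
  mdist l (T l) <= 4 * e.
Proof.
have /andP[b0 /ltW b1] := beta01.
move=> ln ln1 de de1; have e0 : 0 <= e := le_trans (mdist_ge0 _ _) de.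
have dT : mdist (T l) (u n.+1) <= 3 * e.
  rewrite -(ler_pXn2r (ltn0Sn 1)) ?nnegrE ?mdist_ge0 ?mulr_ge0//.
  have step : mdist (u n) (u n.+1) <= 2 * e.
    by rewrite (le_trans (metric_triangle _ l _))// metric_sym; lra.
  have := contr ln (u1 n) ln1; rewrite -!uS => h.
  have {h} : mdist (T l) (u n.+1) ^+ 2
      <= mdist l (u n) ^+ 2 + mdist (u n) (u n.+1) ^+ 2.
    apply: le_trans (le_trans h (ler_piMl _ b1)); first by rewrite lerDl sqr_ge0.
    by rewrite addr_ge0// sqr_ge0.
  (* [e ^+ 2 + (2 * e) ^+ 2 = 5 * e ^+ 2 <= (3 * e) ^+ 2] *)
  move: de step (mdist_ge0 l (u n)) (mdist_ge0 (u n) (u n.+1)); nra.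
rewrite (le_trans (metric_triangle _ (u n.+1) _))// [X in _ + X]metric_sym; lra.
Qed.

Lemma orbit_limit_fixed l : u @ \oo --> l -> T l = l.
Proof.
move=> ul; apply/esym/mdist_positivity/eqP; rewrite eq_le mdist_ge0 andbT.
apply/ler_addgt0Pr => e e0; rewrite add0r.
have e4 : 0 < e / 4 by rewrite divr_gt0.
have [N _ near_l] := metricType_numDomainType.cvgr_dist_le ul e4.
have [n [Nn ln ln1]] := avoid_twice l u1 u2 N.
have := mdist_image_le ln ln1 (near_l _ Nn) (near_l _ (leqW Nn)).
by rewrite mulrC divfK.
Qed.

End orbit.

Theorem theorem2p5 (R : realType) (X : completeMetricType R)
    (card_ge3 : (`I_3 #<= [set: X])%card)
    (T : X -> X) (hT : contracting_hypotenuse T)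
    (no_period2 : ~ (exists x : X, periodic_point2 T x)) :
  fixed_points T !=set0.
Proof.
apply: contrapT => /set0P/negP; rewrite negbK => /eqP noFix.
have T1 x : x != T x.
  apply/eqP => xTx; suff : fixed_points T x by rewrite noFix.
  exact/esym.
have T2 x : x != T (T x).
  apply/eqP => xTTx; apply: no_period2; exists x; split; first exact/esym.
  by apply/eqP; rewrite eq_sym.
case: hT => beta [beta01 contr].
pose u n := iter n T (point : X).
have uS n : u n.+1 = T (u n) by [].
have u1 n : u n != u n.+1 by exact: T1.
have u2 n : u n != u n.+2 by exact: T2.
have q01 : 0 <= Num.sqrt beta < 1.
  by rewrite sqrtr_ge0 -[ltRHS]sqrtr1 ltr_sqrt//; case/andP: beta01.
have u_cvg : cvgn u.
  exact: cvgn_geometric_steps q01 (orbit_step beta01 contr uS u1 u2).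
have := T1 (limn u).
by rewrite (orbit_limit_fixed beta01 contr uS u1 u2 u_cvg) eqxx.
Qed.
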